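(* Let $\tau>0$, $\Lambda\subset\mathbb{R}$ an open interval and $H:\Lambda\times\mathbb{R}\times\mathbb{R}^{2n}\to\mathbb{R}$ continuous with each $H(\lambda,t,\cdot)$ of class $C^2$, all partial derivatives continuous in $(\lambda,t,z)$, and $H(\lambda,t+\tau,z)=H(\lambda,t,z)$, $H(\lambda,-t,Nz)=H(\lambda,t,z)$ for all $(\lambda,t,z)$. Let $v_0$ solve $$\dot u(t)=J\nabla H_{\lambda,t}(u(t)),\quad u(t+\tau)=u(t),\quad u(-t)=Nu(t)\ \forall t\in\mathbb{R}\qquad(\ast)$$ for each $\lambda\in\Lambda$, and let $\gamma_\lambda:[0,\tau]\to{\rm Sp}(2n,\mathbb{R})$ be the fundamental matrix solution of $\dot Z=JH''_{\lambda,t}(v_0(t))Z$, $Z(0)=I$. If $(\mu,v_0)$ is a bifurcation point of $(\ast)$, then $\dot v(t)=JH''_{\mu,t}(v_0(t))v(t)$, $v(t+\tau)=v(t)$, $v(-t)=Nv(t)$ $\forall t$, has nontrivial solutions, i.e. $\nu_{1,\tau}(\gamma_\mu)\neq0$.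
   Context: $J=\begin{pmatrix}0&-I_n\\ I_n&0\end{pmatrix}$, $N=\begin{pmatrix}-I_n&0\\0&I_n\end{pmatrix}$; ${\rm Sp}(2n,\mathbb{R})=\{M:M^TJM=J\}$. $S_\tau=\mathbb{R}/\tau\mathbb{Z}$. $(\mu,v_0)$ is a bifurcation point of $(\ast)$ if each neighbourhood of it in $\Lambda\times W^{1,2}(S_\tau;\mathbb{R}^{2n})$ (equivalently $\Lambda\times C^1(S_\tau;\mathbb{R}^{2n})$) contains $(\lambda,v)$ with $v\ne v_0$ solving $(\ast)$ for $\lambda$. For $\gamma$ with $\gamma(\tau/2)=\begin{pmatrix}A&B\\C&D\end{pmatrix}$ ($n\times n$ blocks), $\nu_{1,\tau}(\gamma)=\dim{\rm Ker}(B)$. *)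

(* Defs.v *)
From HB Require Import structures.
From mathcomp Require Import all_boot all_order all_algebra.
From mathcomp Require Import all_classical all_reals all_analysis.
Set Implicit Arguments. Unset Strict Implicit. Unset Printing Implicit Defensive.
Import Order.TTheory GRing.Theory Num.Theory.
Import numFieldNormedType.Exports.
Local Open Scope classical_set_scope.
Local Open Scope ring_scope.

Section Defs.
Variables (R : realType) (n : nat).
Local Notation V := 'cV[R]_(n + n).

Definition Jmx : 'M[R]_(n + n) := block_mx 0 (- 1%:M) 1%:M 0.
Definition Nmx : 'M[R]_(n + n) := block_mx (- 1%:M) 0 0 1%:M.

Definition grad (f : V -> R) (z : V) : V :=
  \col_(i < n + n) 'd f z (delta_mx i 0).

Definition hess (f : V -> R) (z : V) : 'M[R]_(n + n) :=
  \matrix_(i < n + n, j < n + n) 'd (fun w => grad f w i 0) z (delta_mx j 0).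

Definition is_sol (H : R -> R -> V -> R) (tau l : R) (u : R -> V) : Prop :=
  (forall t, derivable u t 1) /\
  (forall t, derive1 u t = Jmx *m grad (H l t) (u t)) /\
  (forall t, u (t + tau) = u t) /\
  (forall t, u (- t) = Nmx *m u t).

(* (mu, v0) is a bifurcation point of (star): every neighbourhood of (mu, v0)
   in Lambda x C^1(S_tau; R^{2n}) contains a solution (l, v) with v <> v0. *)
Definition bifurcation_point (Lam : set R) (H : R -> R -> V -> R) (tau mu : R)
  (v0 : R -> V) : Prop :=
  forall eps : R, 0 < eps ->
    exists (l : R) (v : R -> V),
      Lam l /\ `|l - mu| < eps /\ is_sol H tau l v /\ v <> v0 /\
      (forall t, `|v t - v0 t| < eps) /\
      (forall t, `|derive1 v t - derive1 v0 t| < eps).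

Definition nu1 (tau : R) (gamma : R -> 'M[R]_(n + n)) : nat :=
  \rank (kermx (ursubmx (gamma (tau / 2%:R)))^T).

End Defs.

Arguments Jmx {R n}.
Arguments Nmx {R n}.

(* Main.v *)
(* If solutions v at parameters l accumulate at (mu, v0), then u = v - v0 solves
   u' = A u, with A(t) = J H''_{mu,t}(v0(t)), up to an error at most e |u| with
   e -> 0, uniformly in t. After normalization |u(0)| = 1, compactness of the
   unit sphere yields a limit y of the initial values, and Gronwall's inequality
   makes u converge uniformly on [0, tau] to gamma_mu y. Since each u is globally
   defined, tau-periodic and N-reversible, so is the limit z, which therefore
   solves the linearized problem on the whole line without any gluing. At t = 0
   and t = tau/2 reversibility and periodicity give z(t) = N z(t), i.e. the first
   n components of z(0) and of gamma_mu(tau/2) z(0) vanish: the last n components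
   of z(0) are a nonzero vector of Ker B. *)

Require Import Defs.
From HB Require Import structures.
From mathcomp Require Import all_boot all_order all_algebra.
From mathcomp Require Import all_classical all_reals all_analysis.
From mathcomp Require Import ring lra.
Import Order.TTheory GRing.Theory Num.Theory.
Import numFieldNormedType.Exports.
Local Open Scope classical_set_scope.
Local Open Scope ring_scope.

Set Implicit Arguments.
Unset Strict Implicit.

(** * Estimates for the sup norm of matrices *)

Lemma coord_le_norm (R : realType) m n (A : 'M[R]_(m, n)) i j :
  `|A i j| <= `|A|.
Proof.
rewrite [leRHS]/Num.Def.normr /= mx_normrE.
exact: (le_bigmax _ (fun ij : 'I_m * 'I_n => `|A ij.1 ij.2|) (i, j)).
Qed.

Lemma norm_le_coord (R : realType) m n (A : 'M[R]_(m, n)) e :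
  0 <= e -> (forall i j, `|A i j| <= e) -> `|A| <= e.
Proof.
move=> e0 Ae; rewrite [leLHS]/Num.Def.normr /= mx_normrE.
by apply: bigmax_le => // -[i j] _; exact: Ae.
Qed.

Lemma sum_le_const (R : realType) m (F : 'I_m -> R) c :
  (forall i, F i <= c) -> \sum_i F i <= m%:R * c.
Proof.
move=> Fc; rewrite (le_trans (ler_sum _ (fun i _ => Fc i)))//.
by rewrite sumr_const card_ord mulr_natl.
Qed.

(** The sup norm is not submultiplicative; the factor [n] counts the summands in each entry of the
    product. *)
Lemma norm_mulmx_le (R : realType) m n p (A : 'M[R]_(m, n)) (B : 'M[R]_(n, p)) :
  `|A *m B| <= n%:R * `|A| * `|B|.
Proof.
apply: norm_le_coord => [|i j]; first by rewrite !mulr_ge0.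
rewrite mxE (le_trans (ler_norm_sum _ _ _))//.
rewrite -mulrA; apply: sum_le_const => k.
by rewrite normrM ler_pM// coord_le_norm.
Qed.

(** * Gronwall's inequality, scalar and vector-valued *)

(** The function exp(-K s) (q(s) + e/K) has derivative exp(-K s) (q' - K q - e) <= 0, so it does not
    increase; the shift e/K absorbs the inhomogeneous term. *)
Lemma gronwall (R : realType) (q dq : R -> R) (K e T : R) :
  0 < K -> {within `[0, T], continuous q} ->
  (forall t, t \in `]0, T[%R -> is_derive t 1 q (dq t)) ->
  (forall t, t \in `]0, T[%R -> dq t <= K * q t + e) ->
  forall t, t \in `[0, T]%R -> q t + e / K <= (q 0 + e / K) * expR (K * t).
Proof.
move=> K0 cq dqP dqle t tT.
pose phi s := expR (- K * s) * (q s + e / K).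
have dphi s : s \in `]0, T[%R ->
    is_derive s 1 phi (expR (- K * s) * (dq s - K * q s - e)).
  move=> /dqP dqs.
  have dE : is_derive s 1 (fun s => expR (- K * s)) (- K * expR (- K * s)).
    have dl : is_derive s 1 (fun s : R => - K * s) (- K).
      have : is_derive s 1 ( *:%R (- K)) (- K *: 1) by exact: is_deriveZ.
      by rewrite scaler1.
    have := is_derive1_comp (is_derive_expR (- K * s)) dl.
    by rewrite mulrC.
  have dQ : is_derive s 1 (fun s => q s + e / K) (dq s).
    have := is_deriveD dqs (is_derive_cst (e / K) s 1).
    by rewrite addr0.
  have := is_deriveM dE dQ.
  rewrite /GRing.scale /=.
  have -> : expR (- K * s) * dq s + (q s + e / K) * (- K * expR (- K * s)) =
    expR (- K * s) * (dq s - K * q s - e) by field; rewrite gt_eqF.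
  by [].
have cphi : {within `[0, T], continuous phi}.
  move=> x; apply: cvgM; last by apply: cvgD; [exact: cq|exact: cvg_cst].
  apply: (@continuous_subspaceT _ _ _ (fun s => expR (- K * s))) => y.
  apply: (@continuous_comp _ _ _ (fun s : R => - K * s) expR).
    exact: mulrl_continuous.
  exact: continuous_expR.
have T0 : 0 <= T by move: tT; rewrite in_itv/= => /andP[t0]; exact: (le_trans t0).
have phidec : phi t <= phi 0.
  apply: (@ler0_derive1_le_cc R phi 0 T) => //.
  - by move=> x /dphi [].
  - move=> x xT; have := dphi _ xT; rewrite derive1E => dx.
    rewrite (@derive_val _ _ _ _ _ _ _ dx).
    rewrite mulr_ge0_le0 ?expR_ge0//.
    by rewrite -addrA -opprD subr_le0; exact: dqle.
  - by rewrite in_itv/= lexx.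
  - by move: tT; rewrite in_itv/= => /andP[].
move: phidec; rewrite /phi mulr0 expR0 mul1r => h.
rewrite -ler_pdivrMr ?expR_gt0// -expRN mulrC.
by rewrite -mulNr.
Qed.

Lemma is_derive_sum_fct (R : realType) m (f : R -> 'I_m -> R)
    (df : 'I_m -> R) (t : R) :
  (forall i, is_derive t 1 (fun s => f s i) (df i)) ->
  is_derive t 1 (fun s => \sum_i f s i) (\sum_i df i).
Proof.
move=> dfP; have := is_derive_sum dfP; congr (is_derive _ _ _ _).
by apply/funext => s; rewrite fct_sumE.
Qed.

(* Gronwall is applied to the Euclidean square norm, which is differentiable,
   and then compared with the sup norm. *)
Lemma gronwall_cV (R : realType) (m : nat) (L T : R) :
  0 <= L -> 0 <= T ->
  exists2 C : R, 0 < C & forall (f g : R -> 'cV[R]_m) (c : R), 0 <= c ->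
    (forall i, {within `[0, T], continuous (fun t => f t i 0)}) ->
    (forall t, t \in `]0, T[%R -> forall i,
      is_derive t 1 (fun s => f s i 0) (g t i 0)) ->
    (forall t, t \in `]0, T[%R -> `|g t| <= L * `|f t| + c) ->
    forall t, t \in `[0, T]%R -> `|f t| <= C * (`|f 0| + c).
Proof.
move=> L0 T0.
pose K := m%:R * (2 * L + 1) + 1.
have K1 : 1 <= K by rewrite lerDr mulr_ge0// addr_ge0// mulr_ge0.
have K0 : 0 < K by exact: lt_le_trans K1.
have E1 : 1 <= expR (K * T).
  by rewrite -expR0 ler_expR mulr_ge0// ltW.
(* The squared estimate needs m exp(K T) <= D^2; taking m + 1 gives D >= 1 even for m = 0, hence D
   <= D^2. *)
pose D := (m%:R + 1) * expR (K * T).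
have D1 : 1 <= D.
  by rewrite -[1]mul1r /D ler_pM// lerDr.
exists D; first exact: lt_le_trans D1.
move=> f g c c0 cf df gle t tT.
pose q s := \sum_i f s i 0 ^+ 2.
have f2q s : `|f s| ^+ 2 <= q s.
  have q0 : 0 <= q s by apply: sumr_ge0 => i _; exact: sqr_ge0.
  rewrite -(sqr_sqrtr q0) ler_sqr ?nnegrE ?sqrtr_ge0//.
  apply: norm_le_coord => [|i j]; first exact: sqrtr_ge0.
  rewrite ord1 -sqrtr_sqr ler_wsqrtr// /q (bigD1 i)//= lerDl.
  by apply: sumr_ge0 => k _; exact: sqr_ge0.
have qf2 s : q s <= m%:R * `|f s| ^+ 2.
  apply: sum_le_const => i.
  by rewrite -[leLHS]real_normK ?num_real// ler_sqr ?nnegrE// coord_le_norm.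
have dq s : s \in `]0, T[%R -> is_derive s 1 q (\sum_i 2 * f s i 0 * g s i 0).
  move=> sT; apply: is_derive_sum_fct => i.
  have := is_deriveX 2 (df s sT i).
  by rewrite /GRing.scale /= expr1 mulr_natl.
have dqle s : s \in `]0, T[%R ->
    \sum_i 2 * f s i 0 * g s i 0 <= K * q s + m%:R * c ^+ 2.
  move=> sT; set F := `|f s|.
  have F0 : 0 <= F by exact: normr_ge0.
  rewrite (@le_trans _ _ (m%:R * ((2 * L + 1) * F ^+ 2 + c ^+ 2)))//.
    apply: sum_le_const => i.
    have h1 := coord_le_norm (f s) i 0.
    have h2 := le_trans (coord_le_norm (g s) i 0) (gle s sT).
    rewrite (le_trans (ler_norm _))// !normrM ger0_norm// -mulrA.
    have h3 : `|f s i 0| * `|g s i 0| <= F * (L * F + c) by rewrite ler_pM.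
    (* This square yields 2 F c <= F^2 + c^2. *)
    have := sqr_ge0 (F - c).
    by move: h3; rewrite -/F; nra.
  rewrite mulrDr lerD2r mulrA.
  rewrite (@le_trans _ _ (m%:R * (2 * L + 1) * q s))//.
    apply: ler_wpM2l; last exact: f2q.
    by rewrite mulr_ge0// addr_ge0// mulr_ge0.
  by rewrite ler_wpM2r ?lerDl// (le_trans _ (f2q s))// sqr_ge0.
have cq : {within `[0, T], continuous q}.
  move=> x; apply: cvg_big => [|i _]; first exact: add_continuous.
  exact: (cvgM (cf i x) (cf i x)).
have := gronwall K0 cq dq dqle tT => gr.
have h4 : `|f t| ^+ 2 <= (D * (`|f 0| + c)) ^+ 2.
  rewrite (le_trans (f2q t))//.
  rewrite (@le_trans _ _ ((q 0 + m%:R * c ^+ 2 / K) * expR (K * t)))//.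
    by rewrite (le_trans _ gr)// lerDl divr_ge0 ?mulr_ge0 ?sqr_ge0// ltW.
  rewrite (@le_trans _ _ (m%:R * (`|f 0| + c) ^+ 2 * expR (K * T)))//.
    have tT' : t <= T by move: tT; rewrite in_itv/= => /andP[].
    have q0 : 0 <= q 0 by apply: sumr_ge0 => i _; exact: sqr_ge0.
    rewrite ler_pM ?expR_ge0//.
    - by rewrite addr_ge0 ?divr_ge0 ?mulr_ge0 ?sqr_ge0// ltW.
    - rewrite (@le_trans _ _ (m%:R * `|f 0| ^+ 2 + m%:R * c ^+ 2))//.
        apply: lerD; first exact: qf2.
        by rewrite ler_pdivrMr// ler_peMr// mulr_ge0// sqr_ge0.
      rewrite -mulrDr ler_wpM2l// sqrrD; have := normr_ge0 (f 0).
      by move: (`|f 0|) c0 => a ? ?; nra.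
    - by rewrite ler_expR ler_wpM2l// ltW.
  rewrite exprMn [leLHS]mulrAC ler_wpM2r ?sqr_ge0//.
  rewrite (@le_trans _ _ D)//; last by rewrite expr2 ler_peMl// (le_trans _ D1).
  by rewrite /D ler_wpM2r ?expR_ge0// lerDl.
have D0 : 0 <= D * (`|f 0| + c) by rewrite mulr_ge0 ?addr_ge0// (le_trans _ D1).
by rewrite -ler_sqr ?nnegrE.
Qed.

(** * Mean value inequality and derivatives of uniform limits *)

Lemma mvt_ineq (R : realType) (u du : R -> R) (a s t e : R) :
  (forall x : R, is_derive x 1 u (du x)) ->
  (forall x, `|x - t| <= `|s - t| -> `|du x - a| <= e) ->
  `|u s - u t - a * (s - t)| <= e * `|s - t|.
Proof.
move=> duP due.
have cu : continuous u.
  by move=> x; apply/differentiable_continuous/derivable1_diffP; case: (duP x).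
suff [c cst ->] : exists2 c, `|c - t| <= `|s - t| & u s - u t = du c * (s - t).
  by rewrite -mulrBl normrM ler_wpM2r// due.
have [st|ts] := leP s t.
- have [c] := MVT_segment st (fun x _ => duP x) (continuous_subspaceT cu).
  rewrite in_itv/= => /andP[sc ct] e1; exists c.
    by rewrite !ler0_norm ?subr_le0// lerN2 lerB.
  by rewrite -[LHS]opprB e1 -mulrN opprB.
- have [c] := MVT_segment (ltW ts) (fun x _ => duP x) (continuous_subspaceT cu).
  rewrite in_itv/= => /andP[sc ct] e1; exists c => //.
  by rewrite !ger0_norm ?subr_ge0// ?(ltW ts)// lerB.
Qed.

(** The mean value inequality for the approximants passes to the limit: the difference quotient of
    [f] at [t] differs from g(t) by at most the oscillation of [g] near [t], which tends to 0 by
    continuity. *)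
Lemma uniform_limit_is_derive (R : realType) (f g : R -> R) :
  continuous g ->
  (forall e : R, 0 < e -> exists u du : R -> R,
    [/\ forall t : R, is_derive t 1 u (du t),
        forall t, `|u t - f t| <= e & forall t, `|du t - g t| <= e]) ->
  forall t : R, is_derive t 1 f (g t).
Proof.
move=> cg fu t.
have key (eta s : R) : (forall x, `|x - t| <= `|s - t| -> `|g x - g t| <= eta) ->
    `|f s - f t - g t * (s - t)| <= eta * `|s - t|.
  move=> geta; apply/ler_addgt0Pr => e e0.
  (* The 2 pays for replacing [f] by [u] at both [s] and [t], and |s - t| for replacing [g] by [du]
     in the mean value inequality. *)
  have S0 : 0 < 2 + `|s - t| by rewrite ltr_wpDr.
  have e'0 : 0 < e / (2 + `|s - t|) by rewrite divr_gt0.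
  have [u [du [duP uf dug]]] := fu _ e'0; set e' := e / _ in e'0 uf dug.
  have H x : `|x - t| <= `|s - t| -> `|du x - g t| <= e' + eta.
    move=> xt; rewrite -(subrKA (g x)) (le_trans (ler_normD _ _))// lerD//.
    exact: geta.
  have h := mvt_ineq duP H.
  have -> : e = e' * (2 + `|s - t|) by rewrite /e' divfK// gt_eqF.
  have -> : f s - f t - g t * (s - t) =
    (u s - u t - g t * (s - t)) + ((u t - f t) - (u s - f s)) by ring.
  rewrite (le_trans (ler_normD _ _))//.
  have := le_trans (ler_normB _ _) (lerD (uf t) (uf s)).
  by move: h; set A := `|_ - _ - _ * _|; set B := `|_ - _ - (_ - _)|; lra.
have cvgf : h^-1 *: (f (h + t) - f t) @[h --> 0^'] --> g t.
  apply/cvgrPdist_le => e e0.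
  have /cvgrPdist_le/(_ e e0)/nbhs_ballP[d /= d0 dg] := cg t.
  near=> h.
  have h0 : h != 0 by near: h; exact: nbhs_dnbhs_neq.
  have hd : `|h| < d by near: h; exact: dnbhs0_lt.
  have H x : `|x - t| <= `|h| -> `|g x - g t| <= e.
    move=> xh; rewrite distrC dg// /ball/= distrC.
    exact: le_lt_trans hd.
  have := key e (h + t); rewrite addrK => /(_ H) le1.
  have hp : 0 < `|h| by rewrite normr_gt0.
  rewrite -(ler_pM2r hp) -normrM mulrBl -normrN opprB /GRing.scale/= mulrAC.
  rewrite mulVf// mul1r.
  exact: le1.
apply: DeriveDef; last by rewrite -derive1E; apply/cvg_lim.
apply/cvg_ex; exists (g t).
by under eq_fun do rewrite [_%:A]mulr1.
Unshelve. all: by end_near. Qed.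

(** * Coordinatewise calculus of matrix-valued functions *)

Lemma is_derive_coord (R : realType) m n (u : R -> 'M[R]_(m, n)) (t : R) i j :
  derivable u t 1 -> is_derive t 1 (fun s => u s i j) (derive1 u t i j).
Proof.
move=> du; rewrite derive1E derive_mx// mxE.
by apply: derivableP; exact: (derivable_mxP u t 1).1.
Qed.

Lemma is_derive_mx (R : realType) m n (u : R -> 'M[R]_(m, n))
    (du : 'M[R]_(m, n)) (t : R) :
  (forall i j, is_derive t 1 (fun s => u s i j) (du i j)) ->
  derivable u t 1 /\ derive1 u t = du.
Proof.
move=> duP.
have dut : derivable u t 1 by apply/derivable_mxP => i j; case: (duP i j).
split=> //; rewrite derive1E derive_mx//; apply/matrixP => i j.
by rewrite mxE; exact: (@derive_val _ _ _ _ _ _ _ (duP i j)).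
Qed.

Lemma cvg_coord (R : realType) (T : Type) (F : set_system T) {FF : Filter F}
    m n (f : T -> 'M[R]_(m, n)) (a : 'M[R]_(m, n)) i j :
  f @ F --> a -> f x i j @[x --> F] --> a i j.
Proof.
move=> fa; apply: (@cvg_comp _ _ _ f (fun M : 'M[R]_(m, n) => M i j) F (nbhs a)) => //.
exact: coord_continuous.
Qed.

Lemma cvg_mulmx_coord (R : realType) (T : Type) (F : set_system T)
    {FF : Filter F} m n p (f : T -> 'M[R]_(m, n)) (g : T -> 'M[R]_(n, p))
    (a : 'M[R]_(m, n)) (b : 'M[R]_(n, p)) i j :
  f @ F --> a -> g @ F --> b -> (f x *m g x) i j @[x --> F] --> (a *m b) i j.
Proof.
move=> fa gb; rewrite mxE; under eq_fun do rewrite mxE.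
apply: cvg_big => [|k _]; first exact: add_continuous.
by apply: cvgM; exact: cvg_coord.
Qed.

Lemma derivable_continuous (R : realType) m n (u : R -> 'M[R]_(m, n)) :
  (forall t, derivable u t 1) -> continuous u.
Proof.
by move=> du t; apply/differentiable_continuous/derivable1_diffP; exact: du.
Qed.

Lemma normr_trmx (R : realType) m n (A : 'M[R]_(m, n)) : `|A^T| = `|A|.
Proof.
apply/eqP; rewrite eq_le; apply/andP; split; apply: norm_le_coord => // i j.
  by rewrite mxE coord_le_norm.
by have := coord_le_norm A^T j i; rewrite mxE.
Qed.

(** * Reduction modulo the period *)

(** For tau > 0 this is the representative of [t] in [0, tau); it carries bounds on one period over
    to the whole line. *)
Definition mod_period (R : realType) (tau t : R) : R :=
  t - tau * (Num.floor (t / tau))%:~R.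

Lemma mod_period_itv (R : realType) (tau t : R) :
  0 < tau -> mod_period tau t \in `[0, tau]%R.
Proof.
move=> tau0; have /andP[] := floor_itv (t / tau).
rewrite intrD1 ler_pdivlMr// ltr_pdivrMr// mulrDl mul1r.
rewrite /mod_period in_itv/= [tau * _]mulrC => h1 h2.
by rewrite subr_ge0 h1 lerBlDl ltW.
Qed.

Lemma mod_period_id (R : realType) (tau t : R) : 0 <= t < tau -> mod_period tau t = t.
Proof.
move=> /andP[t0 ttau]; have tau0 : 0 < tau by exact: le_lt_trans ttau.
rewrite /mod_period (@floor_def _ _ 0) ?mulr0 ?subr0//.
by rewrite divr_ge0 ?(ltW tau0)//= ltr_pdivrMr// mul1r.
Qed.

Lemma periodic_mod (R : realType) (T : Type) (f : R -> T) tau t :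
  (forall s, f (s + tau) = f s) -> f t = f (mod_period tau t).
Proof.
move=> ftau.
have fn s (k : nat) : f (s + tau * k%:R) = f s.
  elim: k s => [|k ih] s; first by rewrite mulr0 addr0.
  by rewrite mulrSr mulrDr mulr1 addrA ftau.
rewrite /mod_period; case: (Num.floor _) => k.
  by rewrite -[in LHS](subrK (tau * k%:R) t) fn.
by rewrite NegzE rmorphN/= mulrN opprK fn.
Qed.

(** * Approximate solutions of a periodic linear system and their limits *)

(** The error is measured relative to |u(t)|, so that the notion is invariant under scaling and
    initial values can be normalized. *)
Definition approx_sol (R : realType) m (A : R -> 'M[R]_m) (N : 'M[R]_m)
    (tau e : R) (u : R -> 'cV[R]_m) : Prop :=
  [/\ forall t, derivable u t 1,
      forall t, `|derive1 u t - A t *m u t| <= e * `|u t|,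
      forall t, u (t + tau) = u t &
      forall t, u (- t) = N *m u t].

Lemma approx_sol_le (R : realType) m (A : R -> 'M[R]_m) N (tau : R) e e' u :
  e <= e' -> approx_sol A N tau e u -> approx_sol A N tau e' u.
Proof.
move=> ee' [du ue up us]; split=> // t.
by rewrite (le_trans (ue t))// ler_wpM2r.
Qed.

Lemma approx_solZ (R : realType) m (A : R -> 'M[R]_m) N (tau : R) e u c :
  approx_sol A N tau e u -> approx_sol A N tau e (fun t => c *: u t).
Proof.
move=> [du ue up us]; split=> [t|t|t|t].
- exact: derivableZ.
- rewrite derive1E (deriveZ c (du t)) -derive1E -scalemxAr -scalerBr !normrZ.
  by rewrite mulrCA ler_wpM2l.
- by rewrite up.
- by rewrite us scalemxAr.
Qed.

(** For e <= 1 one has |u'| <= (m L + 1) |u|, so Gronwall's inequality with c = 0 applies on one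
    period. The constant serves all [u] and [e] at once, and u(0) = 0 forces u = 0. *)
Lemma approx_sol_bound (R : realType) m (A : R -> 'M[R]_m) N (tau : R) L :
  0 < tau -> 0 <= L -> (forall t, `|A t| <= L) ->
  exists2 C : R, 0 < C & forall u e, e <= 1 -> approx_sol A N tau e u ->
    forall t, `|u t| <= C * `|u 0|.
Proof.
move=> tau0 L0 AL.
have K0 : 0 <= m%:R * L + 1 by rewrite addr_ge0 ?mulr_ge0.
have [C C0 HC] := @gronwall_cV R m _ tau K0 (ltW tau0).
exists C => // u e e1 [du ue up _] t.
rewrite (periodic_mod t up) -[X in C * X]addr0.
apply: (HC u (fun s => derive1 u s)) => //.
- move=> i; apply: continuous_subspaceT => s; apply: cvg_coord.
  exact: derivable_continuous.
- by move=> s _ i; exact: is_derive_coord.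
- move=> s _; rewrite addr0 -(subrK (A s *m u s) (derive1 u s)).
  rewrite (le_trans (ler_normD _ _))// mulrDl addrC lerD//.
    by rewrite (le_trans (norm_mulmx_le _ _))// ler_wpM2r// ler_wpM2l.
  by rewrite (le_trans (ue s))// ler_wpM2r.
- exact: mod_period_itv.
Qed.

Lemma periodic_bounded (R : realType) m (A : R -> 'M[R]_m) (tau : R) :
  0 < tau -> continuous A -> (forall t, A (t + tau) = A t) ->
  exists2 L : R, 0 <= L & forall t, `|A t| <= L.
Proof.
move=> tau0 cA Atau.
have cN : {within `[0, tau], continuous (fun t => `|A t|)}.
  by apply: continuous_subspaceT => t; apply: cvg_norm; exact: cA.
have [c _ Ac] := EVT_max (ltW tau0) cN.
exists `|A c| => // t; rewrite (periodic_mod t Atau).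
by apply: Ac; exact: mod_period_itv.
Qed.

Lemma sphere_compact (R : realType) n :
  compact [set x : 'rV[R]_n | `|x| = 1].
Proof.
apply: bounded_closed_compact.
  by exists 1; split=> // M M1 x /= ->; exact: ltW.
apply: (@closed_comp _ _ (fun x : 'rV[R]_n => `|x|) [set 1]).
  by move=> x _; exact: norm_continuous.
exact: closed_eq.
Qed.

(** The normalized initial values of e-approximate solutions form nonempty subsets of the unit
    sphere that shrink with [e]; the filter they generate has a cluster point by compactness. *)
Lemma approx_sol_cluster (R : realType) m (A : R -> 'M[R]_m) N (tau : R) :
  0 < tau -> continuous A -> (forall t, A (t + tau) = A t) ->
  (forall e : R, 0 < e -> exists2 u, approx_sol A N tau e u & u <> (fun=> 0)) ->
  exists2 y : 'cV[R]_m, `|y| = 1 & forall e : R, 0 < e ->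
    exists u, [/\ approx_sol A N tau e u, `|u 0| = 1 & `|u 0 - y| <= e].
Proof.
move=> tau0 cA Atau solA.
have [L L0 AL] := periodic_bounded tau0 cA Atau.
have [C C0 uC] := approx_sol_bound N tau0 L0 AL.
(* Transposition moves the initial values to row vectors, the setting of [sphere_compact]. *)
pose P e := [set x : 'rV[R]_m |
  exists u, [/\ approx_sol A N tau e u, `|u 0| = 1 & x = (u 0)^T]].
have P0 e : 0 < e -> P e !=set0.
  (* Capping the error at 1 makes [approx_sol_bound] available, which shows u(0) to be nonzero. *)
  move=> e0; have m0 : 0 < Num.min e 1 by rewrite lt_min e0 ltr01.
  have [u ue u0] := solA _ m0.
  have u0N : u 0 != 0.
    apply/eqP => u00; apply: u0; apply/funext => t; apply/eqP.
    have := uC u _ _ ue t; rewrite u00 normr0 mulr0 normr_le0; apply.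
    by rewrite ge_min lexx orbT.
  exists (`|u 0|^-1 *: u 0)^T; exists (fun t => `|u 0|^-1 *: u t); split=> //.
    by apply: approx_solZ; apply: approx_sol_le ue; rewrite ge_min lexx.
  by rewrite normrZ normfV normr_id mulVf// normr_eq0.
pose F := filter_from [set e : R | 0 < e] P.
have FF : ProperFilter F.
  apply: filter_from_proper => //; apply: filter_from_filter.
    by exists 1; exact: ltr01.
  move=> e e' /= e0 e'0; exists (Num.min e e'); first by rewrite /= lt_min e0.
  move=> x [u [ue u1 ux]].
  by split; exists u; split=> //; apply: approx_sol_le ue;
    rewrite ge_min lexx ?orbT.
have FS : F [set x : 'rV[R]_m | `|x| = 1].
  by exists 1 => [|x [u [_ u1 ->]]] /=; [exact: ltr01|rewrite normr_trmx].
have [y [y1 Fy]] := sphere_compact FF FS.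
exists y^T; first by rewrite normr_trmx.
move=> e e0.
have FPe : F (P e) by exists e.
have [_ [[u [ue u1 ->]] uy]] := Fy _ _ FPe (nbhsx_ballx y e e0).
exists u; split=> //; apply: ltW.
move: uy; rewrite -ball_normE /= -[y in `|y - _|]trmxK -linearB/= normr_trmx.
by rewrite distrC.
Qed.

Lemma eq_of_norm_le (R : realType) (V : normedModType R) (a b : V) (K : R) :
  (forall e : R, 0 < e -> `|a - b| <= K * e) -> a = b.
Proof.
move=> abK; apply/eqP; rewrite -subr_eq0 -normr_le0.
apply/ler_addgt0Pr => e e0; rewrite add0r.
have K0 : 0 < `|K| + 1 by rewrite ltr_wpDl.
have e'0 : 0 < e / (`|K| + 1) by rewrite divr_gt0.
rewrite (le_trans (abK _ e'0))// mulrA ler_pdivrMr// mulrC ler_wpM2l ?(ltW e0)//.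
by rewrite (le_trans (ler_norm K))// lerDl.
Qed.

(* The propagator [G] carries the convergence of the initial values to uniform
   convergence on [0, tau], hence on the whole line by periodicity. *)
Lemma approx_sol_uniform (R : realType) m (A G : R -> 'M[R]_m) N (tau : R)
    (y : 'cV[R]_m) :
  0 < tau -> continuous A -> (forall t, A (t + tau) = A t) ->
  G 0 = 1%:M -> {within `[0, tau], continuous G} ->
  (forall t : R, 0 < t < tau -> derivable G t 1 /\ derive1 G t = A t *m G t) ->
  (forall e : R, 0 < e ->
    exists u, [/\ approx_sol A N tau e u, `|u 0| = 1 & `|u 0 - y| <= e]) ->
  forall e : R, 0 < e -> exists u, [/\ approx_sol A N tau e u, `|u 0| = 1 &
    forall t, `|u t - G (mod_period tau t) *m y| <= e].
Proof.
move=> tau0 cA Atau G0 cG dG Hy e e0.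
have [L L0 AL] := periodic_bounded tau0 cA Atau.
have [C C0 uC] := approx_sol_bound N tau0 L0 AL.
have K0 : 0 <= m%:R * L by rewrite mulr_ge0.
have [D D0 HD] := @gronwall_cV R m _ tau K0 (ltW tau0).
(* The bound 1 is for [approx_sol_bound], [e] for the approximation claim, and the last term makes
   Gronwall's bound D (e' + e' C) at most [e]. *)
pose e' := Num.min 1 (Num.min e (e / (D * (1 + C)))).
have DC0 : 0 < D * (1 + C) by rewrite mulr_gt0// ltr_wpDr// ltW.
have e'0 : 0 < e' by rewrite !lt_min ltr01 e0 divr_gt0.
have e'1 : e' <= 1 by rewrite ge_min lexx.
have e'e : e' <= e by rewrite !ge_min lexx orbT.
have e'D : D * (e' + e' * C) <= e.
  rewrite -[X in D * (X + _)]mulr1 -mulrDr mulrCA -ler_pdivlMr//.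
  by rewrite !ge_min lexx !orbT.
have [u [ue u1 uy]] := Hy _ e'0.
exists u; split=> //; first exact: approx_sol_le ue.
move=> t; have [du uA up _] := ue.
rewrite (periodic_mod t up).
move: (mod_period_itv t tau0); move: (mod_period tau t) => s sT.
(* The difference satisfies d' = A d + (u' - A u), whose last term is at most e' C because |u| <= C;
   moreover |d(0)| <= e'. *)
pose d s := u s - G s *m y.
pose d' s := derive1 u s - derive1 G s *m y.
have cd i : {within `[0, tau], continuous (fun r => d r i 0)}.
  have -> : (fun r => d r i 0) = (fun r => u r i 0 - (G r *m y) i 0).
    by apply/funext => r; rewrite /d !mxE.
  move=> r.
  apply: cvgB; last by apply: cvg_mulmx_coord; [exact: cG|exact: cvg_cst].
  apply: cvg_coord.
  by apply: continuous_subspaceT => v; exact: derivable_continuous.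
have dd r : r \in `]0, tau[%R -> forall i,
    is_derive r 1 (fun s => d s i 0) (d' r i 0).
  rewrite in_itv/= => /dG[dGr _] i.
  have dsum : is_derive r 1 (fun s => \sum_k G s i k * y k 0)
      (\sum_k derive1 G r i k * y k 0).
    apply: is_derive_sum_fct => k.
    have := is_deriveM (is_derive_coord i k dGr) (is_derive_cst (y k 0) r 1).
    congr (is_derive _ _ _ _).
    by rewrite /GRing.scale/= mulr0 add0r mulrC.
  have := is_deriveB (is_derive_coord i 0 (du r)) dsum.
  congr (is_derive _ _ _ _); last by rewrite /d' !mxE.
  by apply/funext => x; rewrite /d !mxE.
have ddle r : r \in `]0, tau[%R -> `|d' r| <= m%:R * L * `|d r| + e' * C.
  rewrite in_itv/= => /dG[_ Gr].
  have -> : d' r = A r *m d r + (derive1 u r - A r *m u r).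
    by rewrite /d' /d Gr mulmxBr mulmxA [RHS]addrC addrA subrK.
  rewrite (le_trans (ler_normD _ _))// lerD//.
    by rewrite (le_trans (norm_mulmx_le _ _))// ler_wpM2r// ler_wpM2l.
  rewrite (le_trans (uA r))// ler_wpM2l ?(ltW e'0)//.
  by have := uC u e' e'1 ue r; rewrite u1 mulr1.
have eC0 : 0 <= e' * C by rewrite mulr_ge0 ?ltW.
apply: le_trans (HD d d' _ eC0 cd dd ddle s sT) _.
rewrite (le_trans _ e'D)// ler_wpM2l ?(ltW D0)// lerD2r.
by rewrite /d G0 mul1mx.
Qed.

(** Along the approximants [u] converges uniformly to [z] and [u'] to A z, so [z] is differentiable
    everywhere, including at the multiples of [tau], where the equation for [G] gives no
    information. Periodicity and reversibility pass to the limit pointwise. *)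
Lemma approx_sol_limit (R : realType) m (A G : R -> 'M[R]_m) N (tau : R) :
  0 < tau -> continuous A -> (forall t, A (t + tau) = A t) ->
  G 0 = 1%:M -> {within `[0, tau], continuous G} ->
  (forall t : R, 0 < t < tau -> derivable G t 1 /\ derive1 G t = A t *m G t) ->
  (forall e : R, 0 < e -> exists2 u, approx_sol A N tau e u & u <> (fun=> 0)) ->
  exists z : R -> 'cV[R]_m,
    [/\ z 0 <> 0, forall t, derivable z t 1,
        forall t, derive1 z t = A t *m z t &
        [/\ forall t, z (t + tau) = z t, forall t, z (- t) = N *m z t &
            forall t, 0 <= t < tau -> z t = G t *m z 0]].
Proof.
move=> tau0 cA Atau G0 cG dG solA.
have [y y1 Hy] := approx_sol_cluster tau0 cA Atau solA.
pose z t := G (mod_period tau t) *m y.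
have Hz : forall e : R, 0 < e -> exists u, [/\ approx_sol A N tau e u,
    `|u 0| = 1 & forall t, `|u t - z t| <= e].
  exact: approx_sol_uniform.
have z0 : z 0 = y by rewrite /z mod_period_id ?lexx// G0 mul1mx.
have [L L0 AL] := periodic_bounded tau0 cA Atau.
have [C C0 uC] := approx_sol_bound N tau0 L0 AL.
have cz : continuous z.
  move=> t; apply/cvgrPdist_le => e e0.
  have e30 : 0 < e / 3 by rewrite divr_gt0.
  have [u [[du _ _ _] _ uz]] := Hz _ e30.
  have /cvgrPdist_le/(_ _ e30) ut := derivable_continuous du (x := t).
  near=> s.
  have -> : z t - z s = (u t - u s) - (u t - z t) + (u s - z s).
    by apply/matrixP => i j; rewrite !mxE; ring.
  have uts : `|u t - u s| <= e / 3 by near: s; exact: ut.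
  have := ler_normD (u t - u s - (u t - z t)) (u s - z s).
  have := ler_normB (u t - u s) (u t - z t).
  by have := uz t; have := uz s; move: uts; lra.
have dz (t : R) i j : is_derive t 1 (fun s => z s i j) ((A t *m z t) i j).
  apply: (@uniform_limit_is_derive R (fun s => z s i j)
    (fun s => (A s *m z s) i j)).
    by move=> s; apply: cvg_mulmx_coord; [exact: cA|exact: cz].
  move=> e e0.
  have K0 : 0 < 1 + C + m%:R * L.
    by rewrite ltr_wpDr ?mulr_ge0// addr_gt0.
  (* The three summands account for |u - z|, for the equation error e' C, and for |A (u - z)| <= m L
     e'. *)
  pose e' := Num.min 1 (e / (1 + C + m%:R * L)).
  have e'0 : 0 < e' by rewrite lt_min ltr01 divr_gt0.
  have e'1 : e' <= 1 by rewrite ge_min lexx.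
  have e'e : e' * (1 + C + m%:R * L) <= e.
    by rewrite -ler_pdivlMr// ge_min lexx orbT.
  have [u [ue u1 uz]] := Hz _ e'0; have [du uA _ _] := ue.
  exists (fun s => u s i j), (fun s => derive1 u s i j); split=> s.
  - exact: is_derive_coord.
  - have := coord_le_norm (u s - z s) i j; rewrite !mxE => /le_trans; apply.
    rewrite (le_trans (uz s))// (le_trans _ e'e)// ler_peMr ?(ltW e'0)//.
    by rewrite -addrA lerDl addr_ge0 ?mulr_ge0// ltW.
  - have := coord_le_norm (derive1 u s - A s *m z s) i j.
    rewrite [X in `|X|]mxE [X in `|_ + X|]mxE => /le_trans; apply.
    have -> : derive1 u s - A s *m z s =
      (derive1 u s - A s *m u s) + A s *m (u s - z s).
      by rewrite mulmxBr addrA subrK.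
    rewrite (le_trans (ler_normD _ _))// (le_trans _ e'e)//.
    have h1 : `|derive1 u s - A s *m u s| <= e' * C.
      rewrite (le_trans (uA s))// ler_wpM2l ?(ltW e'0)//.
      by have := uC u e' e'1 ue s; rewrite u1 mulr1.
    have h2 : `|A s *m (u s - z s)| <= m%:R * L * e'.
      rewrite (le_trans (norm_mulmx_le _ _))// ler_pM//.
      by rewrite ler_wpM2l.
    by have := lerD h1 h2; move: e'0; lra.
exists z; split.
- by rewrite z0 => y0; move: y1; rewrite y0 normr0 => /esym/eqP; rewrite oner_eq0.
- by move=> t; have [] := is_derive_mx (dz t).
- by move=> t; have [] := is_derive_mx (dz t).
split.
- move=> t; apply: (@eq_of_norm_le _ _ _ _ 2) => e e0.
  have [u [[_ _ up _] _ uz]] := Hz _ e0.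
  rewrite -(subrKA (u t)) (le_trans (ler_normD _ _))// mulr2n mulrDl mul1r lerD//.
  by rewrite -up distrC uz.
- move=> t; apply: (@eq_of_norm_le _ _ _ _ (1 + m%:R * `|N|)) => e e0.
  have [u [[_ _ _ us] _ uz]] := Hz _ e0.
  rewrite -(subrKA (u (- t))) (le_trans (ler_normD _ _))// mulrDl mul1r lerD//.
    by rewrite distrC uz.
  by rewrite us -mulmxBr (le_trans (norm_mulmx_le _ _))// ler_wpM2l ?mulr_ge0.
- by move=> t tT; rewrite z0 /z mod_period_id.
Unshelve. all: by end_near. Qed.

(** * Linearization of the gradient and uniform continuity of the Hessian *)

Lemma hess_mul_is_derive (R : realType) n (f : 'cV[R]_(n + n) -> R) z w (s : R) i :
  differentiable (grad f) (z + s *: w) ->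
  is_derive s 1 (fun r => grad f (z + r *: w) i 0) ((hess f (z + s *: w) *m w) i 0).
Proof.
move=> dgf; set x := z + s *: w in dgf *.
have dc : differentiable (fun v => grad f v i 0) x.
  apply: (@differentiable_comp _ _ _ _ (grad f)
    (fun M : 'cV[R]_(n + n) => M i 0)) => //.
  exact: differentiable_coord.
have -> : (hess f x *m w) i 0 = 'd (fun v => grad f v i 0) x w.
  rewrite [in RHS](matrix_sum_delta w) linear_sum/= mxE; apply: eq_bigr => k _.
  by rewrite big_ord1 linearZ/= mxE mulrC.
have dl : is_diff s (fun r => z + r *: w) (fun r => r *: w).
  have := is_diffD (is_diff_cst z s) (is_diff_scalel s w).
  by rewrite add0r.
have dcs : is_diff x (fun v => grad f v i 0) ('d (fun v => grad f v i 0) x).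
  exact: DiffDef.
have := @is_diff_comp _ _ _ _ _ _ _ _ _ dl dcs.
move=> [d1 d2]; apply: DeriveDef; first exact: diff_derivable.
by rewrite deriveE// d2/= scale1r.
Qed.

(** The mean value theorem is applied to each coordinate of the gradient along the segment from z to
    z + w. The intermediate point depends on the coordinate, which is harmless since the Hessian
    bound holds on the whole segment. *)
Lemma grad_linear_approx (R : realType) n (f : 'cV[R]_(n + n) -> R) z w
    (B : 'M[R]_(n + n)) (e : R) :
  (forall x, differentiable (grad f) x) ->
  (forall s, 0 <= s <= 1 -> `|hess f (z + s *: w) - B| <= e) ->
  `|grad f (z + w) - grad f z - B *m w| <= (n + n)%:R * e * `|w|.
Proof.
move=> dgf hB.
have e0 : 0 <= e by apply: le_trans (hB 0 _); rewrite ?normr_ge0// lexx ler01.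
apply: norm_le_coord => [|i j]; first by rewrite !mulr_ge0.
rewrite ord1 => {j}.
have dg (s : R) : is_derive s 1 (fun r => grad f (z + r *: w) i 0)
  ((hess f (z + s *: w) *m w) i 0) by exact: hess_mul_is_derive.
have cg : {within `[0, 1], continuous (fun r => grad f (z + r *: w) i 0)}.
  apply: continuous_subspaceT => s.
  by apply/differentiable_continuous/derivable1_diffP; case: (dg s).
have [c] := MVT_segment ler01 (fun s _ => dg s) cg.
rewrite in_itv/= scale0r addr0 scale1r subr0 mulr1 => c01 e1.
have -> : (grad f (z + w) - grad f z - B *m w) i 0 =
    ((hess f (z + c *: w) - B) *m w) i 0.
  have sub_coord (a b : 'cV[R]_(n + n)) : (a - b) i 0 = a i 0 - b i 0.
    by rewrite !mxE.
  by rewrite mulmxBl !sub_coord e1.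
rewrite (le_trans (coord_le_norm _ _ _))// (le_trans (norm_mulmx_le _ _))//.
by rewrite ler_wpM2r// ler_wpM2l// hB.
Qed.

(** Continuity at each point (mu, t, v(t)) gives a local radius; compactness of [0, T], in its
    near-covering form, turns these into one radius for all [t]. *)
Lemma hess_uniform (R : realType) n (Hs : R -> R -> 'cV[R]_(n + n) -> 'M[R]_(n + n))
    (v : R -> 'cV[R]_(n + n)) (mu T : R) :
  continuous v ->
  (forall t, {for (mu, t, v t), continuous
    (fun p : R * R * 'cV[R]_(n + n) => Hs p.1.1 p.1.2 p.2)}) ->
  forall e : R, 0 < e -> exists2 d : R, 0 < d & forall t l w, t \in `[0, T]%R ->
    `|l - mu| < d -> `|w| < d -> `|Hs l t (v t + w) - Hs mu t (v t)| <= e.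
Proof.
move=> cv cH e e0.
pose P (p : R * 'cV[R]_(n + n)) (t : R) : Prop :=
  `|Hs p.1 t (v t + p.2) - Hs mu t (v t)| <= e.
have e20 : 0 < e / 2 by rewrite divr_gt0.
have loc t0 : `[0, T]%classic t0 ->
    \forall t \near t0 & p \near (mu, 0 : 'cV[R]_(n + n)), P p t.
  move=> _.
  have /cvgrPdist_le/(_ _ e20)/nbhs_ballP[d /= d0 hd] := cH t0.
  have d20 : 0 < d / 2 by rewrite divr_gt0.
  have le_d2 : d / 2 <= d by rewrite ler_pdivrMr// ler_peMr ?ler1n// ltW.
  have vd : \forall t \near t0, ball (v t0) (d / 2) (v t).
    exact: (cv t0 _ (nbhsx_ballx (v t0) _ d20)).
  exists ([set t | ball t0 d t /\ ball (v t0) (d / 2) (v t)],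
          ball (mu, 0 : 'cV[R]_(n + n)) (d / 2)).
    by split; [exact: filterI (nbhsx_ballx t0 _ d0) vd|exact: nbhsx_ballx].
  move=> [t [l w]] [/= [t0t vt] [/= mul w0]].
  have vw : ball (v t0) d (v t + w).
    move: vt w0; rewrite -!ball_normE/= sub0r => vt w0.
    by rewrite opprD addrA (le_lt_trans (ler_normD _ _))// (splitr d) ltrD.
  (* Both values are compared with the one at the centre (mu, t0, v(t0)), each at a cost of e/2. *)
  have k1 : `|Hs mu t0 (v t0) - Hs l t (v t + w)| <= e / 2.
    by apply: (hd (l, t, v t + w)); split=> //; split=> //; exact: le_ball mul.
  have k2 : `|Hs mu t0 (v t0) - Hs mu t (v t)| <= e / 2.
    apply: (hd (mu, t, v t)); split=> /=; last exact: le_ball vt.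
    by split=> //=; exact: ballxx.
  rewrite /P/=.
  rewrite -(subrKA (Hs mu t0 (v t0))) (splitr e) (le_trans (ler_normD _ _))//.
  by rewrite lerD// distrC.
have /nbhs_ballP[d /= d0 dP] : nbhs (mu, 0 : 'cV[R]_(n + n))
    [set p | `[0, T]%classic `<=` P p].
  exact: (compact_near_coveringP _).1 (@segment_compact R 0 T) _ _ P _ loc.
 exists d => // t l w tT lmu wd.
have : ball (mu, 0 : 'cV[R]_(n + n)) d (l, w).
  by split; rewrite -ball_normE /ball_/= ?sub0r ?normrN// distrC.
by move=> /dP/(_ t tT).
Qed.

Lemma hess_curve_continuous (R : realType) n
    (Hs : R -> R -> 'cV[R]_(n + n) -> 'M[R]_(n + n))
    (M : 'M[R]_(n + n)) (v : R -> 'cV[R]_(n + n)) (mu : R) :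
  continuous v ->
  (forall t, {for (mu, t, v t), continuous
    (fun p : R * R * 'cV[R]_(n + n) => Hs p.1.1 p.1.2 p.2)}) ->
  continuous (fun t => M *m Hs mu t (v t)).
Proof.
move=> cv cH t; apply/cvgrPdist_le => e e0.
have K0 : 0 <= (n + n)%:R * `|M| by rewrite mulr_ge0.
have K1 : 0 < (n + n)%:R * `|M| + 1 by rewrite ltr_wpDl.
have e'0 : 0 < e / ((n + n)%:R * `|M| + 1) by rewrite divr_gt0.
have /cvgrPdist_le/(_ _ e'0)/nbhs_ballP[d /= d0 hd] := cH t.
near=> s.
have ts : ball t d s by near: s; exact: (nbhsx_ballx t d d0).
have vts : ball (v t) d (v s).
  by near: s; exact: (cv t _ (nbhsx_ballx (v t) _ d0)).
rewrite -mulmxBr (le_trans (norm_mulmx_le _ _))//.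
rewrite (@le_trans _ _ (((n + n)%:R * `|M| + 1) *
  `|Hs mu t (v t) - Hs mu s (v s)|))//; first by rewrite ler_wpM2r// lerDl.
rewrite mulrC -ler_pdivlMr//; apply: (hd (mu, s, v s)).
by do 2![split=> //=]; exact: ballxx.
Unshelve. all: by end_near. Qed.

(** * Reversibility and the kernel of the block B *)

Lemma usubmx_fixed_Nmx (R : realType) n (x : 'cV[R]_(n + n)) :
  x = Nmx *m x -> usubmx x = 0.
Proof.
move=> /(congr1 usubmx).
rewrite -{2}[x]vsubmxK /Nmx mul_block_col !mul0mx addr0 col_mxKu mulNmx mul1mx.
move=> /matrixP uN; apply/matrixP => i j; move: (uN i j); rewrite !mxE => h.
by lra.
Qed.

(** Writing x = (0, y), the upper half of G(tau/2) x is B y, so [y] is a nonzero element of Ker B.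
    If [nu1] vanished, the transpose of B would be row free and [y] would be 0. *)
Lemma nu1_neq0 (R : realType) n (tau : R) (G : R -> 'M[R]_(n + n))
    (x : 'cV[R]_(n + n)) :
  x <> 0 -> usubmx x = 0 -> usubmx (G (tau / 2) *m x) = 0 ->
  nu1 tau G <> 0%N.
Proof.
move=> x0 ux; rewrite -{1}[G (tau / 2)]submxK -{1}[x]vsubmxK mul_block_col col_mxKu.
rewrite ux mulmx0 add0r => Bx /eqP; rewrite /nu1 mxrank_eq0 kermx_eq0 => rB.
apply: x0; rewrite -[x]vsubmxK ux; suff -> : dsubmx x = 0 by rewrite col_mx0.
apply: trmx_inj; apply: (row_free_inj rB).
by rewrite -trmx_mul Bx !trmx0 mul0mx.
Qed.

(** * From bifurcation to the linearized problem *)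

Lemma bifurcation_approx_sol (R : realType) (n : nat) (tau : R) (Lam : set R)
    (H : R -> R -> 'cV[R]_(n + n) -> R) (v0 : R -> 'cV[R]_(n + n)) (mu : R) :
  0 < tau ->
  (forall l t z, Lam l -> differentiable (grad (H l t)) z) ->
  (forall l t z, Lam l -> {for (l, t, z), continuous
    (fun p : R * R * 'cV[R]_(n + n) => hess (H p.1.1 p.1.2) p.2)}) ->
  (forall l t z, Lam l -> H l (t + tau) z = H l t z) ->
  (forall l, Lam l -> is_sol H tau l v0) ->
  Lam mu -> bifurcation_point Lam H tau mu v0 ->
  forall e : R, 0 < e -> exists2 u : R -> 'cV[R]_(n + n),
    approx_sol (fun t => Jmx *m hess (H mu t) (v0 t)) Nmx tau e u &
    u <> (fun=> 0).
Proof.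
move=> tau0 dH cH Htau solv0 Lmu bif e e0.
(* One factor 2n |J| comes from multiplying by J, the other 2n from [grad_linear_approx]. *)
pose K := (n + n)%:R * `|Jmx : 'M[R]_(n + n)| * (n + n)%:R.
have K0 : 0 <= K by rewrite !mulr_ge0.
have K1 : 0 < K + 1 by rewrite ltr_wpDl.
have e10 : 0 < e / (K + 1) by rewrite divr_gt0.
have [dv0 [_ [v0tau v0N]]] := solv0 _ Lmu.
have Hper l t : Lam l -> H l t = H l (mod_period tau t).
  by move=> Ll; apply: periodic_mod => s; apply/funext => z; exact: Htau.
have [d d0 hd] := @hess_uniform R n (fun l t => hess (H l t)) v0 mu tau
  (derivable_continuous dv0) (fun t => cH mu t (v0 t) Lmu) _ e10.
have [l [v [Ll [lmu [[dv [vE [vtau vN]]] [vv0 [vd _]]]]]]] := bif _ d0.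
(* Since [v0] also solves the system at the parameter [l] of [v], the derivative of v - v0 is J
   applied to a difference of gradients of the same function H(l, t, .). *)
have [_ [v0E _]] := solv0 _ Ll.
exists (fun t => v t - v0 t); last first.
  move=> u0; apply: vv0; apply/funext => t; apply/eqP.
  by rewrite -subr_eq0 -[_ - _]/((fun t => v t - v0 t) t) u0.
split=> [t|t|t|t].
- exact: derivableB.
- rewrite derive1E deriveB// -!derive1E vE v0E -mulmxBr -mulmxA -mulmxBr.
  rewrite (le_trans (norm_mulmx_le _ _))//.
  have hs s : 0 <= s <= 1 ->
      `|hess (H l t) (v0 t + s *: (v t - v0 t)) - hess (H mu t) (v0 t)|
        <= e / (K + 1).
    (* The radius [d] is uniform over one period only, so [t] is first reduced to [0, tau]. *)
    move=> /andP[s0 s1]; rewrite !(Hper _ t)// (periodic_mod t v0tau).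
    apply: hd => //; first exact: mod_period_itv.
    rewrite -(periodic_mod t v0tau) normrZ (le_lt_trans _ (vd t))//.
    by rewrite ger0_norm// ler_piMl.
  have := grad_linear_approx (fun z => dH l t z Ll) hs.
  rewrite [v0 t + _]addrC subrK => happ.
  apply: le_trans (ler_wpM2l _ happ) _; first by rewrite mulr_ge0.
  rewrite !mulrA -/K ler_wpM2r// ler_pdivrMr// mulrC.
  by rewrite ler_wpM2l ?(ltW e0)// lerDl.
- by rewrite vtau v0tau.
- by rewrite vN v0N mulmxBr.
Qed.

Unset Implicit Arguments.

Theorem theorem6p1 (R : realType) (n : nat) (tau : R) (Lam : set R)
    (H : R -> R -> 'cV[R]_(n + n) -> R) (v0 : R -> 'cV[R]_(n + n))
    (gamma : R -> R -> 'M[R]_(n + n)) (mu : R) :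
  0 < tau ->
  (* Lambda is an open interval *)
  open Lam -> is_interval Lam -> Lam !=set0 ->
  (* regularity of H: each H(l,t,.) is C^2; H and all its partial derivatives
     in z are continuous in (l,t,z) *)
  (forall l t z, Lam l -> differentiable (H l t) z) ->
  (forall l t z, Lam l -> differentiable (grad (H l t)) z) ->
  (forall l t z, Lam l ->
     {for (l, t, z), continuous (fun p : R * R * 'cV[R]_(n + n) => H p.1.1 p.1.2 p.2)}) ->
  (forall l t z, Lam l ->
     {for (l, t, z), continuous (fun p : R * R * 'cV[R]_(n + n) => grad (H p.1.1 p.1.2) p.2)}) ->
  (forall l t z, Lam l ->
     {for (l, t, z), continuous (fun p : R * R * 'cV[R]_(n + n) => hess (H p.1.1 p.1.2) p.2)}) ->
  (* symmetries of H *)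
  (forall l t z, Lam l -> H l (t + tau) z = H l t z) ->
  (forall l t z, Lam l -> H l (- t) (Nmx *m z) = H l t z) ->
  (* v0 solves (star) for every l in Lambda *)
  (forall l, Lam l -> is_sol H tau l v0) ->
  (* gamma_l : [0,tau] -> Sp(2n) is the fundamental matrix solution of
     Z' = J H''_{l,t}(v0(t)) Z, Z(0) = I *)
  (forall l, Lam l ->
     gamma l 0 = 1%:M /\
     {within `[0, tau], continuous (gamma l)} /\
     (forall t, 0 < t < tau ->
        derivable (gamma l) t 1 /\
        derive1 (gamma l) t = Jmx *m hess (H l t) (v0 t) *m gamma l t)) ->
  Lam mu ->
  bifurcation_point Lam H tau mu v0 ->
  (exists v : R -> 'cV[R]_(n + n),
     v <> (fun _ => 0) /\
     (forall t, derivable v t 1) /\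
     (forall t, derive1 v t = Jmx *m hess (H mu t) (v0 t) *m v t) /\
     (forall t, v (t + tau) = v t) /\
     (forall t, v (- t) = Nmx *m v t)) /\
  nu1 tau (gamma mu) <> 0%N.
Proof.
move=> tau0 _ _ _ _ dH _ _ cH Htau _ solv0 gammaP Lmu bif.
have [G0 [cG dG]] := gammaP _ Lmu.
have [dv0 [_ [v0tau _]]] := solv0 _ Lmu.
pose A t := Jmx *m hess (H mu t) (v0 t).
have cA : continuous A.
  apply: (@hess_curve_continuous R n (fun l t => hess (H l t))).
    exact: derivable_continuous.
  by move=> t; exact: cH.
have Atau t : A (t + tau) = A t.
  have HE : H mu (t + tau) = H mu t by apply/funext => z; exact: Htau.
  by rewrite /A v0tau HE.
have [z [z0 dz zE [ztau zN zG]]] := approx_sol_limit tau0 cA Atau G0 cG dG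
  (bifurcation_approx_sol tau0 dH cH Htau solv0 Lmu bif).
split.
  exists z; split; last by [].
  by move=> zz; apply: z0; rewrite zz.
apply: (nu1_neq0 (x := z 0)) => //.
  by apply: usubmx_fixed_Nmx; rewrite -zN oppr0.
rewrite -zG; last by rewrite divr_ge0 ?(ltW tau0)//= ltr_pdivrMr// ltr_pMr// ltr1n.
(* Here N z(tau/2) = z(-tau/2) = z(-tau/2 + tau) = z(tau/2). *)
apply: usubmx_fixed_Nmx; rewrite -zN -[RHS]ztau; congr z; lra.
Qed.
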